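(* Let $\mathcal{C}$ be a multifusion category over $\Bbbk$. Then the following are equivalent: (1) the unit object $1$ is simple, i.e. $\mathcal{C}$ is a fusion category; (2) for any non-zero algebra $A$ in $\mathcal{C}$, the functor $-\otimes A:\mathcal{C}\to\mathcal{C}_A$ is separable; (3) for any non-zero coalgebra $C$ in $\mathcal{C}$, the functor $-\otimes C:\mathcal{C}\to\mathcal{C}^C$ is separable; (4) for any non-zero algebra $A$ in $\mathcal{C}$, the functor $-\otimes A:\mathcal{C}\to\mathcal{C}_A$ is faithful; (5) for any non-zero coalgebra $C$ in $\mathcal{C}$, the functor $-\otimes C:\mathcal{C}\to\mathcal{C}^C$ is faithful; (6) for any non-zero algebra $A$ in $\mathcal{C}$, the functor $-\otimes A:\mathcal{C}\to\mathcal{C}_A$ is Maschke; (7) for any non-zero coalgebra $C$ in $\mathcal{C}$, the functor $-\otimes C:\mathcal{C}\to\mathcal{C}^C$ is Maschke; (8) for any non-zero algebra $A$ in $\mathcal{C}$, the functor $-\otimes A:\mathcal{C}\to\mathcal{C}_A$ is dual Maschke; (9) for any non-zero coalgebra $C$ in $\mathcal{C}$, the functor $-\otimes C:\mathcal{C}\to\mathcal{C}^C$ is dual Maschke; (10) for any non-zero algebra $A$ in $\mathcal{C}$, the functor $-\otimes A:\mathcal{C}\to\mathcal{C}_A$ is conservative; (11) for any non-zero coalgebra $C$ in $\mathcal{C}$, the functor $-\otimes C:\mathcal{C}\to\mathcal{C}^C$ is conservative; (12) for any non-zero algebra $A$ in $\mathcal{C}$, its unit $u_A:1\to A$ is a monomorphism;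 (13) for any non-zero coalgebra $C$ in $\mathcal{C}$, its counit $\varepsilon_C:C\to 1$ is an epimorphism; (14) any non-zero algebra morphism $f:1\to A$ in $\mathcal{C}$ is a monomorphism; (15) any non-zero coalgebra morphism $f:C\to 1$ in $\mathcal{C}$ is an epimorphism.
   Context: $\Bbbk$ is an algebraically closed field; monoidal categories are assumed strict, with tensor product $\otimes$ and unit object $1$. A multitensor category over $\Bbbk$ is a locally finite (finite-dimensional Hom spaces, all objects of finite length) $\Bbbk$-linear abelian rigid monoidal category with bilinear tensor product. A multifusion category is a finite (finitely many isomorphism classes of simple objects, enough projectives) semisimple multitensor category; a fusion category is a multifusion category with $\mathrm{End}_{\mathcal{C}}(1)=\Bbbk$. A nonzero object is simple if $0$ and itself are its only subobjects; an abelian category is semisimple if every object is a direct sum of simple objects. For an algebra $(A,m_A,u_A)$ in $\mathcal{C}$, $\mathcal{C}_A$ is the category of right $A$-modules in $\mathcal{C}$, and $-\otimes A:\mathcal{C}\to\mathcal{C}_A$ is $M\mapsto (M\otimes A, M\otimes m_A)$, $f\mapsto f\otimes A$. For a coalgebra $(C,\Delta_C,\varepsilon_C)$ in $\mathcal{C}$, $\mathcal{C}^C$ is the category of right $C$-comodules in $\mathcal{C}$, and $-\otimes C:\mathcal{C}\to\mathcal{C}^C$ is $M\mapsto (M\otimes C, M\otimes\Delta_C)$, $f\mapsto f\otimes C$. A functor $F:\mathcal{C}\to\mathcal{D}$ is separable if there is a natural transformation $\mathcal{P}:\mathrm{Hom}_{\mathcal{D}}(F-,F-)\to\mathrm{Hom}_{\mathcal{C}}(-,-)$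 with $\mathcal{P}(F(f))=f$ for every morphism $f$ in $\mathcal{C}$. $F$ is Maschke if it reflects split-monomorphisms (if $F(i)$ is split-mono then $i$ is split-mono), dual Maschke if it reflects split-epimorphisms, and conservative if it reflects isomorphisms.
   Formalization: The multifusion category is assumed to be nonzero: in the zero category the unit object is not simple, while conditions (2)–(15) hold vacuously. *)

(* Defs.v *)
From HB Require Import structures.
From mathcomp Require Import all_boot all_algebra.
From mathcomp Require Import boolp.

Set Implicit Arguments.
Unset Strict Implicit.
Unset Printing Implicit Defensive.

Import GRing.Theory.

Local Obligation Tactic := idtac.

Declare Scope cat_scope.
Delimit Scope cat_scope with cat.
Local Open Scope ring_scope.
Local Open Scope cat_scope.

Reserved Notation "g ∘ f" (at level 40, left associativity).
Reserved Notation "X ⊗ Y" (at level 38, left associativity).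
Reserved Notation "f ⊗⊗ g" (at level 38, left associativity).

Record category := Category {
  Ob :> Type;
  Hom : Ob -> Ob -> Type;
  idm : forall X, Hom X X;
  comp : forall X Y Z, Hom Y Z -> Hom X Y -> Hom X Z;
  compA : forall W X Y Z (h : Hom Y Z) (g : Hom X Y) (f : Hom W X),
    comp h (comp g f) = comp (comp h g) f;
  comp1m : forall X Y (f : Hom X Y), comp (idm Y) f = f;
  compm1 : forall X Y (f : Hom X Y), comp f (idm X) = f
}.
Arguments Hom {_} _ _.
Arguments idm {_} X.
Arguments comp {_ _ _ _} g f.
Notation "g ∘ f" := (comp g f) : cat_scope.

Section CategoryNotions.
Variable C : category.
Implicit Types X Y : C.

Definition is_mono X Y (f : Hom X Y) :=
  forall W (g h : Hom W X), f ∘ g = f ∘ h -> g = h.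
Definition is_epi X Y (f : Hom X Y) :=
  forall Z (g h : Hom Y Z), g ∘ f = h ∘ f -> g = h.
Definition is_split_mono X Y (f : Hom X Y) := exists r : Hom Y X, r ∘ f = idm X.
Definition is_split_epi X Y (f : Hom X Y) := exists s : Hom Y X, f ∘ s = idm Y.
Definition is_iso X Y (f : Hom X Y) :=
  exists g : Hom Y X, g ∘ f = idm X /\ f ∘ g = idm Y.
Definition isomorphic X Y := exists f : Hom X Y, is_iso f.

Definition is_zero X :=
  forall Y, (exists! f : Hom X Y, True) /\ (exists! f : Hom Y X, True).

(* A subobject [i : Y -> X] is [0] when its source is a zero object, and is [X]
   itself when [i] is invertible. *)
Definition is_simple X :=
  ~ is_zero X /\
  forall Y (i : Hom Y X), is_mono i -> is_zero Y \/ is_iso i.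

Definition is_projective (P : C) :=
  forall X Y (e : Hom X Y), is_epi e ->
  forall f : Hom P Y, exists g : Hom P X, e ∘ g = f.

End CategoryNotions.

Record functor (C D : category) := Functor {
  fob :> C -> D;
  fmap : forall X Y : C, Hom X Y -> Hom (fob X) (fob Y);
  fmap1 : forall X : C, fmap (idm X) = idm (fob X);
  fmapM : forall (X Y Z : C) (g : Hom Y Z) (f : Hom X Y),
    fmap (g ∘ f) = fmap g ∘ fmap f
}.
Arguments fmap {C D} F {X Y} f : rename.

Section FunctorNotions.
Variables (C D : category) (F : functor C D).

(* [P] is a natural transformation between the functors [Hom_D(F-, F-)] and
   [Hom_C(-, -)] on [C^op * C], and it retracts the action of [F]. *)
Definition separable :=
  exists P : forall X Y : C, Hom (F X) (F Y) -> Hom X Y,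
    (forall (X X' Y Y' : C) (f : Hom X' X) (h : Hom Y Y') (g : Hom (F X) (F Y)),
       P X' Y' (fmap F h ∘ g ∘ fmap F f) = h ∘ P X Y g ∘ f) /\
    (forall (X Y : C) (f : Hom X Y), P X Y (fmap F f) = f).

Definition faithful :=
  forall (X Y : C) (f g : Hom X Y), fmap F f = fmap F g -> f = g.
Definition maschke :=
  forall (X Y : C) (i : Hom X Y), is_split_mono (fmap F i) -> is_split_mono i.
Definition dual_maschke :=
  forall (X Y : C) (p : Hom X Y), is_split_epi (fmap F p) -> is_split_epi p.
Definition conservative :=
  forall (X Y : C) (f : Hom X Y), is_iso (fmap F f) -> is_iso f.

End FunctorNotions.

(* [GRing.Lmodule.axioms_ k (Hom X Y)] is the class of [lmodType k] structures
   on the type [Hom X Y]; storing the class rather than a packed [lmodType]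
   keeps the carrier of the Hom space syntactically equal to [Hom X Y]. *)
Record linear_category (k : fieldType) := LinearCategory {
  lin_cat :> category;
  hom_lmod : forall X Y : lin_cat, GRing.Lmodule.axioms_ k (Hom X Y);
  hom_lmodType := fun X Y => GRing.Lmodule.Pack (hom_lmod X Y);
  comp_linear_l : forall (X Y Z : lin_cat) (f : Hom X Y),
    linear ((fun g => g ∘ f) : hom_lmodType Y Z -> hom_lmodType X Z);
  comp_linear_r : forall (X Y Z : lin_cat) (g : Hom Y Z),
    linear ((fun f => g ∘ f) : hom_lmodType X Y -> hom_lmodType X Z)
}.

HB.instance Definition _ (k : fieldType) (C : linear_category k) (X Y : C) :=
  hom_lmod X Y.

Section LinearNotions.
Variables (k : fieldType) (C : linear_category k).
Implicit Types X Y Z : C.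

Definition is_kernel X Y (f : Hom X Y) K (i : Hom K X) :=
  f ∘ i = 0 /\
  forall W (g : Hom W X), f ∘ g = 0 -> exists! h : Hom W K, i ∘ h = g.
Definition is_cokernel X Y (f : Hom X Y) Q (p : Hom Y Q) :=
  p ∘ f = 0 /\
  forall Z (g : Hom Y Z), g ∘ f = 0 -> exists! h : Hom Q Z, h ∘ p = g.

Definition is_direct_sum (n : nat) (S : 'I_n -> C) X :=
  exists (i : forall j, Hom (S j) X) (p : forall j, Hom X (S j)),
    [/\ forall j, p j ∘ i j = idm (S j),
        forall j l, j != l -> p l ∘ i j = 0
      & \sum_j i j ∘ p j = idm X].

Definition is_abelian :=
  [/\ (exists X, is_zero X) /\
      (forall (S : 'I_2 -> C), exists X, is_direct_sum S X),
      forall X Y (f : Hom X Y), exists K (i : Hom K X), is_kernel f i,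
      forall X Y (f : Hom X Y), exists Q (p : Hom Y Q), is_cokernel f p,
      forall X Y (i : Hom X Y), is_mono i ->
        exists Z (f : Hom Y Z), is_kernel f i
    & forall X Y (p : Hom X Y), is_epi p ->
        exists W (f : Hom W X), is_cokernel f p].

Definition short_exact X Y Z (i : Hom X Y) (p : Hom Y Z) :=
  is_kernel p i /\ is_cokernel i p.

(* Existence of a composition series. *)
Inductive finite_length : C -> Prop :=
| finite_length_zero X : is_zero X -> finite_length X
| finite_length_ext X Y Z (i : Hom X Y) (p : Hom Y Z) :
    short_exact i p -> finite_length X -> is_simple Z -> finite_length Y.

Definition is_locally_finite :=
  (forall X Y, exists (n : nat) (v : {linear Hom X Y -> 'rV[k]_n}),
     bijective v) /\
  (forall X, finite_length X).

Definition is_finite :=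
  (exists (n : nat) (S : 'I_n -> C),
     forall X, is_simple X -> exists j, isomorphic X (S j)) /\
  (forall X, exists (P : C) (p : Hom P X), is_projective P /\ is_epi p).

(* The empty sum is allowed, so that zero objects are covered; objects of
   finite length admit only finite decompositions. *)
Definition is_semisimple :=
  forall X, exists (n : nat) (S : 'I_n -> C),
    (forall j, is_simple (S j)) /\ is_direct_sum S X.

End LinearNotions.

(* Associativity and unit constraints are part of the data: strict monoidal
   categories are the case where they are identities. *)
Record monoidal_linear_category (k : fieldType) := MonoidalLinearCategory {
  mon_lin :> linear_category k;
  unit_ob : mon_lin;
  tens : mon_lin -> mon_lin -> mon_lin;
  tensm : forall X X' Y Y' : mon_lin,
    Hom X X' -> Hom Y Y' -> Hom (tens X Y) (tens X' Y');
  assoc : forall X Y Z : mon_lin, Hom (tens (tens X Y) Z) (tens X (tens Y Z));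
  associ : forall X Y Z : mon_lin, Hom (tens X (tens Y Z)) (tens (tens X Y) Z);
  lunit : forall X : mon_lin, Hom (tens unit_ob X) X;
  luniti : forall X : mon_lin, Hom X (tens unit_ob X);
  runit : forall X : mon_lin, Hom (tens X unit_ob) X;
  runiti : forall X : mon_lin, Hom X (tens X unit_ob);
  tensm1 : forall X Y : mon_lin, tensm (idm X) (idm Y) = idm (tens X Y);
  tensmM : forall (X X' X'' Y Y' Y'' : mon_lin)
      (f' : Hom X' X'') (f : Hom X X') (g' : Hom Y' Y'') (g : Hom Y Y'),
    tensm (f' ∘ f) (g' ∘ g) = tensm f' g' ∘ tensm f g;
  associK : forall X Y Z : mon_lin, associ X Y Z ∘ assoc X Y Z = idm _;
  assocK : forall X Y Z : mon_lin, assoc X Y Z ∘ associ X Y Z = idm _;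
  lunitiK : forall X : mon_lin, luniti X ∘ lunit X = idm _;
  lunitK : forall X : mon_lin, lunit X ∘ luniti X = idm _;
  runitiK : forall X : mon_lin, runiti X ∘ runit X = idm _;
  runitK : forall X : mon_lin, runit X ∘ runiti X = idm _;
  assoc_nat : forall (X X' Y Y' Z Z' : mon_lin)
      (f : Hom X X') (g : Hom Y Y') (h : Hom Z Z'),
    assoc X' Y' Z' ∘ tensm (tensm f g) h = tensm f (tensm g h) ∘ assoc X Y Z;
  lunit_nat : forall (X X' : mon_lin) (f : Hom X X'),
    lunit X' ∘ tensm (idm unit_ob) f = f ∘ lunit X;
  runit_nat : forall (X X' : mon_lin) (f : Hom X X'),
    runit X' ∘ tensm f (idm unit_ob) = f ∘ runit X;
  pentagon : forall W X Y Z : mon_lin,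
    assoc W X (tens Y Z) ∘ assoc (tens W X) Y Z =
    tensm (idm W) (assoc X Y Z) ∘ assoc W (tens X Y) Z
      ∘ tensm (assoc W X Y) (idm Z);
  triangle : forall X Y : mon_lin,
    tensm (idm X) (lunit Y) ∘ assoc X unit_ob Y = tensm (runit X) (idm Y)
}.
Arguments unit_ob {_} C : rename.
Arguments tens {_ _} X Y.
Arguments tensm {_ _ _ _ _ _} f g.
Arguments assoc {_ _} X Y Z.
Arguments associ {_ _} X Y Z.
Arguments lunit {_ _} X.
Arguments luniti {_ _} X.
Arguments runit {_ _} X.
Arguments runiti {_ _} X.
Notation "X ⊗ Y" := (tens X Y) : cat_scope.
Notation "f ⊗⊗ g" := (tensm f g) : cat_scope.

Section MonoidalNotions.
Variables (k : fieldType) (C : monoidal_linear_category k).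
Implicit Types X Y : C.

Definition bilinear_tensor :=
  (forall (X X' Y Y' : C) (g : Hom Y Y'),
     linear (fun f : Hom X X' => f ⊗⊗ g)) /\
  (forall (X X' Y Y' : C) (f : Hom X X'),
     linear (fun g : Hom Y Y' => f ⊗⊗ g)).

(* [Y] is a left dual of [X]; equivalently, [X] is a right dual of [Y]. *)
Definition is_left_dual Y X :=
  exists (ev : Hom (Y ⊗ X) (unit_ob C)) (coev : Hom (unit_ob C) (X ⊗ Y)),
    runit X ∘ (idm X ⊗⊗ ev) ∘ assoc X Y X ∘ (coev ⊗⊗ idm X) = lunit X /\
    lunit Y ∘ (ev ⊗⊗ idm Y) ∘ associ Y X Y ∘ (idm Y ⊗⊗ coev) = runit Y.

Definition is_rigid :=
  forall X, (exists Y, is_left_dual Y X) /\ (exists Z, is_left_dual X Z).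

End MonoidalNotions.

Record multitensor_category (k : fieldType) := MultitensorCategory {
  mt_mon :> monoidal_linear_category k;
  mt_abelian : is_abelian mt_mon;
  mt_locally_finite : is_locally_finite mt_mon;
  mt_rigid : is_rigid mt_mon;
  mt_bilinear : bilinear_tensor mt_mon
}.

Definition is_multifusion (k : fieldType) (C : multitensor_category k) :=
  is_finite C /\ is_semisimple C.

(* [End(1) = k]: scalars act on the unit object through a bijection. *)
Definition is_fusion (k : fieldType) (C : multitensor_category k) :=
  is_multifusion C /\
  bijective (fun a : k => a *: idm (unit_ob C) : Hom (unit_ob C) (unit_ob C)).

Section UnitCoherence.
Variables (k : fieldType) (C : monoidal_linear_category k).
Implicit Types X Y Z : C.
Local Notation "1" := (unit_ob C) : cat_scope.

Lemma tensm_idM X Y Y' Y'' (g' : Hom Y' Y'') (g : Hom Y Y') :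
  idm X ⊗⊗ (g' ∘ g) = (idm X ⊗⊗ g') ∘ (idm X ⊗⊗ g).
Proof. by rewrite -tensmM comp1m. Qed.

Lemma tensm_Mid X X' X'' Y (f' : Hom X' X'') (f : Hom X X') :
  (f' ∘ f) ⊗⊗ idm Y = (f' ⊗⊗ idm Y) ∘ (f ⊗⊗ idm Y).
Proof. by rewrite -tensmM comp1m. Qed.

Lemma unit_tensm_inj X Y (f g : Hom X Y) :
  idm 1 ⊗⊗ f = idm 1 ⊗⊗ g -> f = g.
Proof.
move=> fg; rewrite -[f]compm1 -[g]compm1 -(lunitK X) !compA.
by rewrite -!lunit_nat fg.
Qed.

Lemma tensm_unit_inj X Y (f g : Hom X Y) :
  f ⊗⊗ idm 1 = g ⊗⊗ idm 1 -> f = g.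
Proof.
move=> fg; rewrite -[f]compm1 -[g]compm1 -(runitK X) !compA.
by rewrite -!runit_nat fg.
Qed.

Lemma comp_assocI X Y Z W (f g : Hom (X ⊗ (Y ⊗ Z)) W) :
  f ∘ assoc X Y Z = g ∘ assoc X Y Z -> f = g.
Proof.
by move=> fg; rewrite -[f]compm1 -[g]compm1 -(assocK X Y Z) !compA fg.
Qed.

Lemma lunit_tens X Y : lunit (X ⊗ Y) ∘ assoc 1 X Y = lunit X ⊗⊗ idm Y.
Proof.
apply: unit_tensm_inj; apply: comp_assocI.
have epiA : is_epi (assoc 1 1 X ⊗⊗ idm Y).
  move=> Z g h gh; rewrite -[g]compm1 -[h]compm1 -tensm1 -(assocK 1 1 X).
  by rewrite tensm_Mid !compA gh.
apply: epiA; rewrite tensm_idM -assoc_nat -[RHS]compA -tensm_Mid triangle.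
rewrite [RHS]assoc_nat tensm1 -triangle -[RHS]compA.
by rewrite pentagon !compA.
Qed.

Lemma runit_tens X Y : runit (X ⊗ Y) = (idm X ⊗⊗ runit Y) ∘ assoc X Y 1.
Proof.
have monoA : is_mono (assoc X Y 1).
  by move=> W g h gh; rewrite -[g]comp1m -[h]comp1m -associK -!compA gh.
apply: tensm_unit_inj; apply: monoA; rewrite -triangle tensm_Mid.
rewrite -[in LHS]tensm1 !compA !assoc_nat -compA pentagon -triangle.
by rewrite tensm_idM !compA.
Qed.

Lemma associ_nat X X' Y Y' Z Z' (f : Hom X X') (g : Hom Y Y') (h : Hom Z Z') :
  associ X' Y' Z' ∘ (f ⊗⊗ (g ⊗⊗ h)) = ((f ⊗⊗ g) ⊗⊗ h) ∘ associ X Y Z.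
Proof.
apply: comp_assocI; rewrite -!compA associK compm1 -assoc_nat compA associK.
by rewrite comp1m.
Qed.

Lemma lunit_unit_tens X : lunit (1 ⊗ X) = idm 1 ⊗⊗ lunit X.
Proof.
have monoL : is_mono (lunit X).
  move=> W g h gh; rewrite -[g]comp1m -[h]comp1m -(lunitiK X).
  by rewrite -!compA gh.
by apply: monoL; rewrite lunit_nat.
Qed.

Lemma lunit_runit1 : lunit 1 = runit 1.
Proof.
by apply: tensm_unit_inj; rewrite -lunit_tens lunit_unit_tens triangle.
Qed.

Lemma luniti_runiti1 : luniti 1 = runiti 1.
Proof.
by rewrite -[luniti 1]comp1m -runitiK -lunit_runit1 -compA lunitK compm1.
Qed.

Lemma assoc_lunit1 :
  lunit 1 ∘ (lunit 1 ⊗⊗ idm 1) = lunit 1 ∘ (idm 1 ⊗⊗ lunit 1) ∘ assoc 1 1 1.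
Proof. by rewrite -compA triangle lunit_runit1. Qed.

Lemma assoc_luniti1 :
  assoc 1 1 1 ∘ (luniti 1 ⊗⊗ idm 1) ∘ luniti 1 =
  (idm 1 ⊗⊗ luniti 1) ∘ luniti 1.
Proof.
have monoL : is_mono (idm 1 ⊗⊗ lunit 1).
  move=> W g h gh; rewrite -[g]comp1m -[h]comp1m -tensm1 -(lunitiK 1).
  by rewrite tensm_idM -!compA gh.
apply: monoL; rewrite !compA triangle -lunit_runit1 -tensm_Mid -tensm_idM.
by rewrite lunitK !tensm1.
Qed.

End UnitCoherence.

Record algebra (k : fieldType) (C : monoidal_linear_category k) := Algebra {
  alg_ob :> C;
  alg_mul : Hom (alg_ob ⊗ alg_ob) alg_ob;
  alg_unit : Hom (unit_ob C) alg_ob;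
  alg_mulA : alg_mul ∘ (alg_mul ⊗⊗ idm alg_ob) =
    alg_mul ∘ (idm alg_ob ⊗⊗ alg_mul) ∘ assoc alg_ob alg_ob alg_ob;
  alg_mul1m : alg_mul ∘ (alg_unit ⊗⊗ idm alg_ob) = lunit alg_ob;
  alg_mulm1 : alg_mul ∘ (idm alg_ob ⊗⊗ alg_unit) = runit alg_ob
}.

Definition is_algebra_morphism (k : fieldType)
    (C : monoidal_linear_category k) (A B : algebra C) (f : Hom A B) :=
  f ∘ alg_mul A = alg_mul B ∘ (f ⊗⊗ f) /\ f ∘ alg_unit A = alg_unit B.

Program Definition unit_algebra (k : fieldType)
    (C : monoidal_linear_category k) : algebra C :=
  @Algebra k C (unit_ob C) (lunit (unit_ob C)) (idm (unit_ob C)) _ _ _.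
Next Obligation. by move=> k C; exact: assoc_lunit1. Qed.
Next Obligation. by move=> k C; rewrite tensm1 compm1. Qed.
Next Obligation. by move=> k C; rewrite tensm1 compm1 lunit_runit1. Qed.

Section Modules.
Variables (k : fieldType) (C : monoidal_linear_category k) (A : algebra C).

Record module := Module {
  mod_ob :> C;
  mod_act : Hom (mod_ob ⊗ A) mod_ob;
  mod_actA : mod_act ∘ (mod_act ⊗⊗ idm A) =
    mod_act ∘ (idm mod_ob ⊗⊗ alg_mul A) ∘ assoc mod_ob A A;
  mod_act1 : mod_act ∘ (idm mod_ob ⊗⊗ alg_unit A) = runit mod_ob
}.

Definition is_module_morphism (M N : module) (f : Hom M N) :=
  f ∘ mod_act M = mod_act N ∘ (f ⊗⊗ idm A).

Definition module_hom (M N : module) := {f : Hom M N | is_module_morphism f}.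

Lemma module_hom_inj (M N : module) (f g : module_hom M N) :
  sval f = sval g -> f = g.
Proof. by case: f g => [f Pf] [g Pg] /= fg; exact: eq_exist. Qed.

Lemma is_module_morphism1 (M : module) : is_module_morphism (idm M).
Proof. by rewrite /is_module_morphism tensm1 comp1m compm1. Qed.

Lemma is_module_morphismM (M N P : module) (g : Hom N P) (f : Hom M N) :
  is_module_morphism g -> is_module_morphism f -> is_module_morphism (g ∘ f).
Proof.
rewrite /is_module_morphism => gP fP.
by rewrite -compA fP compA gP -compA -tensm_Mid.
Qed.

Definition module_id (M : module) : module_hom M M :=
  exist _ (idm M) (is_module_morphism1 M).
Definition module_comp (M N P : module) (g : module_hom N P)
    (f : module_hom M N) : module_hom M P :=
  exist _ (sval g ∘ sval f) (is_module_morphismM (svalP g) (svalP f)).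

Program Definition module_category : category :=
  @Category module module_hom module_id module_comp _ _ _.
Next Obligation. by move=> *; apply: module_hom_inj; exact: compA. Qed.
Next Obligation. by move=> *; apply: module_hom_inj; exact: comp1m. Qed.
Next Obligation. by move=> *; apply: module_hom_inj; exact: compm1. Qed.

Program Definition free_module (M : C) : module :=
  @Module (M ⊗ A) ((idm M ⊗⊗ alg_mul A) ∘ assoc M A A) _ _.
Next Obligation.
move=> M; rewrite tensm_Mid compA -(compA _ (assoc M A A)) assoc_nat.
rewrite compA -tensm_idM alg_mulA !tensm_idM -!compA (compA _ _ (assoc M A A ⊗⊗ _)).
rewrite -pentagon -(tensm1 M A).
by congr (_ ∘ _); rewrite [RHS]compA assoc_nat -!compA.
Qed.
Next Obligation.
move=> M; rewrite -tensm1 -compA assoc_nat compA -tensm_idM alg_mulm1.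
by rewrite runit_tens.
Qed.

Lemma free_module_fmap_subproof (M N : C) (f : Hom M N) :
  @is_module_morphism (free_module M) (free_module N) (f ⊗⊗ idm A).
Proof.
rewrite /is_module_morphism /=. rewrite -[RHS]compA assoc_nat !compA -!tensmM.
by rewrite tensm1 !comp1m !compm1.
Qed.

Program Definition free_module_functor : functor C module_category :=
  @Functor C module_category free_module
    (fun M N f => exist _ (f ⊗⊗ idm A) (free_module_fmap_subproof f)) _ _.
Next Obligation. by move=> M; apply: module_hom_inj; exact: tensm1. Qed.
Next Obligation. by move=> *; apply: module_hom_inj; exact: tensm_Mid. Qed.

End Modules.

Record coalgebra (k : fieldType) (C : monoidal_linear_category k) := Coalgebra {
  coalg_ob :> C;
  coalg_comul : Hom coalg_ob (coalg_ob ⊗ coalg_ob);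
  coalg_counit : Hom coalg_ob (unit_ob C);
  coalg_comulA :
    assoc coalg_ob coalg_ob coalg_ob ∘ (coalg_comul ⊗⊗ idm coalg_ob)
      ∘ coalg_comul = (idm coalg_ob ⊗⊗ coalg_comul) ∘ coalg_comul;
  coalg_comul1m : (coalg_counit ⊗⊗ idm coalg_ob) ∘ coalg_comul = luniti coalg_ob;
  coalg_comulm1 : (idm coalg_ob ⊗⊗ coalg_counit) ∘ coalg_comul = runiti coalg_ob
}.

Definition is_coalgebra_morphism (k : fieldType)
    (C : monoidal_linear_category k) (D E : coalgebra C) (f : Hom D E) :=
  coalg_comul E ∘ f = (f ⊗⊗ f) ∘ coalg_comul D /\
  coalg_counit E ∘ f = coalg_counit D.

Program Definition unit_coalgebra (k : fieldType)
    (C : monoidal_linear_category k) : coalgebra C :=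
  @Coalgebra k C (unit_ob C) (luniti (unit_ob C)) (idm (unit_ob C)) _ _ _.
Next Obligation. by move=> k C; exact: assoc_luniti1. Qed.
Next Obligation. by move=> k C; rewrite tensm1 comp1m. Qed.
Next Obligation. by move=> k C; rewrite tensm1 comp1m luniti_runiti1. Qed.

Section Comodules.
Variables (k : fieldType) (C : monoidal_linear_category k) (D : coalgebra C).

Record comodule := Comodule {
  comod_ob :> C;
  comod_coact : Hom comod_ob (comod_ob ⊗ D);
  comod_coactA : assoc comod_ob D D ∘ (comod_coact ⊗⊗ idm D) ∘ comod_coact =
    (idm comod_ob ⊗⊗ coalg_comul D) ∘ comod_coact;
  comod_coact1 : (idm comod_ob ⊗⊗ coalg_counit D) ∘ comod_coact = runiti comod_ob
}.

Definition is_comodule_morphism (M N : comodule) (f : Hom M N) :=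
  comod_coact N ∘ f = (f ⊗⊗ idm D) ∘ comod_coact M.

Definition comodule_hom (M N : comodule) :=
  {f : Hom M N | is_comodule_morphism f}.

Lemma comodule_hom_inj (M N : comodule) (f g : comodule_hom M N) :
  sval f = sval g -> f = g.
Proof. by case: f g => [f Pf] [g Pg] /= fg; exact: eq_exist. Qed.

Lemma is_comodule_morphism1 (M : comodule) : is_comodule_morphism (idm M).
Proof. by rewrite /is_comodule_morphism tensm1 comp1m compm1. Qed.

Lemma is_comodule_morphismM (M N P : comodule) (g : Hom N P) (f : Hom M N) :
  is_comodule_morphism g -> is_comodule_morphism f ->
  is_comodule_morphism (g ∘ f).
Proof.
rewrite /is_comodule_morphism => gP fP.
by rewrite compA gP -compA fP compA -tensm_Mid.
Qed.

Definition comodule_id (M : comodule) : comodule_hom M M :=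
  exist _ (idm M) (is_comodule_morphism1 M).
Definition comodule_comp (M N P : comodule) (g : comodule_hom N P)
    (f : comodule_hom M N) : comodule_hom M P :=
  exist _ (sval g ∘ sval f) (is_comodule_morphismM (svalP g) (svalP f)).

Program Definition comodule_category : category :=
  @Category comodule comodule_hom comodule_id comodule_comp _ _ _.
Next Obligation. by move=> *; apply: comodule_hom_inj; exact: compA. Qed.
Next Obligation. by move=> *; apply: comodule_hom_inj; exact: comp1m. Qed.
Next Obligation. by move=> *; apply: comodule_hom_inj; exact: compm1. Qed.

Program Definition cofree_comodule (M : C) : comodule :=
  @Comodule (M ⊗ D) (associ M D D ∘ (idm M ⊗⊗ coalg_comul D)) _ _.
Next Obligation.
move=> M.
have monoA : is_mono (assoc M D (D ⊗ D)).
  by move=> W g h gh; rewrite -[g]comp1m -[h]comp1m -associK -!compA gh.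
apply: monoA; rewrite -[in RHS]tensm1 !compA assoc_nat pentagon.
rewrite -(compA _ (assoc M D D ⊗⊗ _)) -tensm_Mid compA assocK comp1m.
rewrite -(compA _ (assoc M (D ⊗ D) D)) assoc_nat.
have cancelA W (g : Hom W (M ⊗ (D ⊗ D))) :
    assoc M D D ∘ (associ M D D ∘ g) = g by rewrite compA assocK comp1m.
rewrite -!compA !cancelA -!tensm_idM.
by rewrite compA coalg_comulA.
Qed.
Next Obligation.
move=> M.
have monoR : is_mono (runit (M ⊗ D)).
  by move=> W g h gh; rewrite -[g]comp1m -[h]comp1m -runitiK -!compA gh.
apply: monoR; rewrite runitK runit_tens -tensm1 !compA.
rewrite -(compA _ (assoc M D _)) assoc_nat -!compA (compA (assoc M D D)) assocK.
by rewrite comp1m -!tensm_idM coalg_comulm1 runitK tensm1.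
Qed.

Lemma cofree_comodule_fmap_subproof (M N : C) (f : Hom M N) :
  @is_comodule_morphism (cofree_comodule M) (cofree_comodule N) (f ⊗⊗ idm D).
Proof.
rewrite /is_comodule_morphism /= compA -associ_nat -!compA -!tensmM.
by rewrite tensm1 !comp1m !compm1.
Qed.

Program Definition cofree_comodule_functor : functor C comodule_category :=
  @Functor C comodule_category cofree_comodule
    (fun M N f => exist _ (f ⊗⊗ idm D) (cofree_comodule_fmap_subproof f)) _ _.
Next Obligation. by move=> M; apply: comodule_hom_inj; exact: tensm1. Qed.
Next Obligation. by move=> *; apply: comodule_hom_inj; exact: tensm_Mid. Qed.

End Comodules.

(* Main.v *)
From HB Require Import structures.
Require Import Defs.
From mathcomp Require Import all_boot all_algebra.
From mathcomp Require Import boolp.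
Import Defs.

Import GRing.Theory.
Local Open Scope ring_scope.
Local Open Scope cat_scope.

(** Write 1 for the unit object, and call a nonzero algebra A (or coalgebra D)
    split when its unit 1 -> A (or counit D -> 1) has a one-sided inverse.

    If 1 is simple, every nonzero algebra A is split: its unit is nonzero,
    because multiplying by it is the identity of A, and in a semisimple category
    a nonzero morphism out of a simple object is a split monomorphism
    ([split_mono_from_simple], from Schur's lemma). A retraction r of the unit u
    makes X a natural retract of X ⊗ A through X ⊗ u and X ⊗ r, so [- ⊗ A] is
    separable ([tensor_retraction]). Separability implies faithfulness, the two
    Maschke properties and conservativity for any functor.

    Conversely, let Y be a nonzero direct factor of 1, with inclusion i,
    projection p and idempotent e = i ∘ p. Then Y is an algebra with unit p and
    a coalgebra with counit i ([retract_algebra], [retract_coalgebra]), and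
    e ⊗ Y is the identity ([retract_idem_tensm]). So [- ⊗ Y] sends the
    idempotent e to an identity. A functor which is faithful, Maschke, dual
    Maschke or conservative does that only to identities
    ([detects_trivial_idempotents]); hence each of these properties, required of
    [- ⊗ Y], forces e to be the identity of 1. So does the condition that p is a
    monomorphism, or that i is an epimorphism, since p ∘ i is the identity of Y.
    A nonzero object of a semisimple category all of whose nonzero direct
    factors are trivial in this sense is simple
    ([simple_of_trivial_retracts]). Both directions work in the same way for
    algebras and for coalgebras, so all conditions are compared with the
    simplicity of 1.

    The conditions on morphisms 1 -> A and D -> 1 restate those on units and
    counits: a morphism of algebras out of 1 is the unit of its target. Finally,
    End(1) is the base field exactly when 1 is simple: one direction is the
    existence of eigenvalues over an algebraically closed field
    ([simple_End_scalar]); for the other, an idempotent of the base field is 0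
    or 1 ([simple_of_scalar_End]). *)

Set Implicit Arguments.
Unset Strict Implicit.
Unset Printing Implicit Defensive.

(** * Isomorphisms and idempotents *)

Section Categories.
Variable C : category.
Implicit Types X Y : C.

Lemma iso_split_mono X Y (f : Hom X Y) : is_iso f -> is_split_mono f.
Proof. by case=> g [gf _]; exists g. Qed.

Lemma split_iso X Y (f : Hom X Y) :
  is_split_mono f -> is_split_epi f -> is_iso f.
Proof.
case=> r rf [s fs]; exists r; split=> //.
suff -> : r = s by [].
by rewrite -[r]compm1 -fs compA rf comp1m.
Qed.

Lemma idem_split_mono X (e : Hom X X) :
  e ∘ e = e -> is_split_mono e -> e = idm X.
Proof. by move=> ee [r re]; rewrite -[LHS]comp1m -re -compA ee. Qed.

Lemma idem_split_epi X (e : Hom X X) :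
  e ∘ e = e -> is_split_epi e -> e = idm X.
Proof. by move=> ee [s es]; rewrite -[LHS]compm1 -es compA ee. Qed.

End Categories.

(** * What the functor properties say about idempotents *)

Section Functors.
Variables (C D : category) (F : functor C D).

(** The common weak consequence of the five functor properties, and the only one
    that the converse implications use: each of them, tested on the single
    morphism [e], forces [e] to be an identity. *)
Definition detects_trivial_idempotents :=
  forall (X : C) (e : Hom X X),
    e ∘ e = e -> fmap F e = idm (F X) -> e = idm X.

Lemma separable_faithful : separable F -> faithful F.
Proof. by case=> P [_ PF] X Y f g fg; rewrite -(PF _ _ f) fg PF. Qed.

(** Naturality of the retraction [P] turns a retraction [r] of [F i] into the
    retraction [P r] of [i]. *)
Lemma separable_maschke : separable F -> maschke F.
Proof.
case=> P [Pnat PF] X Y i [r ri]; exists (P _ _ r).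
rewrite -[LHS]comp1m compA -Pnat fmap1 comp1m ri -fmap1; exact: PF.
Qed.

Lemma separable_dual_maschke : separable F -> dual_maschke F.
Proof.
case=> P [Pnat PF] X Y p [s ps]; exists (P _ _ s).
rewrite -[LHS]compm1 -Pnat fmap1 compm1 ps -fmap1; exact: PF.
Qed.

Lemma separable_conservative : separable F -> conservative F.
Proof.
move=> sepF X Y f [g [gf fg]]; apply: split_iso.
  by apply: separable_maschke => //; exists g.
by apply: separable_dual_maschke => //; exists g.
Qed.

Lemma faithful_detects : faithful F -> detects_trivial_idempotents.
Proof. by move=> faF X e _ Fe; apply: faF; rewrite Fe fmap1. Qed.

Lemma maschke_detects : maschke F -> detects_trivial_idempotents.
Proof.
move=> maF X e ee Fe; apply: idem_split_mono => //; apply: maF.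
by exists (idm (F X)); rewrite Fe comp1m.
Qed.

Lemma dual_maschke_detects : dual_maschke F -> detects_trivial_idempotents.
Proof.
move=> maF X e ee Fe; apply: idem_split_epi => //; apply: maF.
by exists (idm (F X)); rewrite Fe comp1m.
Qed.

Lemma conservative_detects : conservative F -> detects_trivial_idempotents.
Proof.
move=> coF X e ee Fe; apply: idem_split_mono => //.
apply/iso_split_mono/coF; exists (idm (F X)).
by rewrite Fe comp1m.
Qed.

End Functors.

(** * Simple objects in linear categories *)

Section LinearCategories.
Variables (k : fieldType) (C : linear_category k).
Implicit Types X Y Z S : C.

Lemma compBm X Y Z (g h : Hom Y Z) (f : Hom X Y) :
  (g - h) ∘ f = g ∘ f - h ∘ f.
Proof.
by rewrite addrC -scaleN1r (comp_linear_l f (-1) h g) scaleN1r addrC.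
Qed.

Lemma compmB X Y Z (g : Hom Y Z) (f h : Hom X Y) :
  g ∘ (f - h) = g ∘ f - g ∘ h.
Proof.
by rewrite addrC -scaleN1r (comp_linear_r g (-1) h f) scaleN1r addrC.
Qed.

Lemma comp0m X Y Z (f : Hom X Y) : (0 : Hom Y Z) ∘ f = 0.
Proof. by rewrite -(subrr (0 : Hom Y Z)) compBm subrr. Qed.

Lemma compm0 X Y Z (g : Hom Y Z) : g ∘ (0 : Hom X Y) = 0.
Proof. by rewrite -(subrr (0 : Hom X Y)) compmB subrr. Qed.

Lemma compmD X Y Z (g : Hom Y Z) (f h : Hom X Y) :
  g ∘ (f + h) = g ∘ f + g ∘ h.
Proof. by rewrite -[f]scale1r (comp_linear_r g 1 f h) !scale1r. Qed.

Lemma compDm X Y Z (g h : Hom Y Z) (f : Hom X Y) :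
  (g + h) ∘ f = g ∘ f + h ∘ f.
Proof. by rewrite -[g]scale1r (comp_linear_l f 1 g h) !scale1r. Qed.

Lemma compZm X Y Z a (g : Hom Y Z) (f : Hom X Y) :
  (a *: g) ∘ f = a *: (g ∘ f).
Proof. by rewrite -[a *: g]addr0 (comp_linear_l f a g 0) comp0m addr0. Qed.

Lemma compm_sum X Y Z (g : Hom Y Z) n (f : 'I_n -> Hom X Y) :
  g ∘ (\sum_j f j) = \sum_j g ∘ f j.
Proof.
by apply: (big_morph (fun h => g ∘ h)) => [f1 f2|]; rewrite ?compmD ?compm0.
Qed.

Lemma comp_summ X Y Z n (g : 'I_n -> Hom Y Z) (f : Hom X Y) :
  (\sum_j g j) ∘ f = \sum_j g j ∘ f.
Proof.
by apply: (big_morph (fun h => h ∘ f)) => [g1 g2|]; rewrite ?compDm ?comp0m.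
Qed.

Lemma is_zeroE X : is_zero X <-> idm X = 0.
Proof.
split=> [/(_ X) [[f [_ uf]] _]|X0 Y].
  by rewrite -(uf (idm X)) // (uf 0).
split; exists 0; split=> // f _; first by rewrite -[f]compm1 X0 compm0.
by rewrite -[f]comp1m X0 comp0m.
Qed.

Lemma isomorphic_simple X Y : isomorphic X Y -> is_simple X -> is_simple Y.
Proof.
case=> f [g [gf fg]] [X0 Xsimple]; split.
  move/is_zeroE => Y0; apply/X0/is_zeroE.
  by rewrite -gf -[g]compm1 Y0 compm0 comp0m.
move=> W j monoj.
have monogj : is_mono (g ∘ j).
  move=> V u v; rewrite -!compA => /(congr1 (fun h => f ∘ h)).
  by rewrite !(compA f g) fg !comp1m; apply: monoj.
have [W0|[h [hgj gjh]]] := Xsimple _ _ monogj; first by left.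
right; exists (h ∘ g); split; first by rewrite -compA.
by rewrite -[LHS]comp1m -fg -!compA (compA j) (compA g) (compA g) gjh comp1m.
Qed.

Hypothesis C_abelian : is_abelian C.

(** Schur's lemma: the kernel of [f] is a proper subobject of [X], hence zero,
    so that [f] exhibits [X] as a nonzero subobject of [Y]. *)
Lemma simple_hom_iso X Y (f : Hom X Y) :
  is_simple X -> is_simple Y -> f <> 0 -> is_iso f.
Proof.
move=> [X0 Xsimple] [_ Ysimple] f0.
have [_ kers _ _ _] := C_abelian.
have [K [i [fi univ]]] := kers _ _ f.
have monoi : is_mono i.
  move=> W g h gh; have [|u [_ uu]] := univ W (i ∘ g).
    by rewrite compA fi comp0m.
  by rewrite -(uu g) // (uu h).
have [K0|[j [ji ij]]] := Xsimple _ _ monoi; last first.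
  by case: f0; rewrite -[f]compm1 -ij compA fi comp0m.
have monof : is_mono f.
  move=> W g h gh; apply/eqP; rewrite -subr_eq0; apply/eqP.
  have [|u [<- _]] := univ W (g - h); first by rewrite compmB gh subrr.
  by rewrite -[i]compm1 (is_zeroE K).1 // compm0 comp0m.
by case: (Ysimple _ _ monof).
Qed.

Hypothesis C_semisimple : is_semisimple C.

(** Some component of [f] along a decomposition of the target into simple
    objects is nonzero, hence invertible. *)
Lemma split_mono_from_simple S X (f : Hom S X) :
  is_simple S -> f <> 0 -> is_split_mono f.
Proof.
move=> Ssimple f0.
have [n [T [Tsimple [i [p [_ _ ip]]]]]] := C_semisimple X.
have [|none] := pselect (exists j, p j ∘ f <> 0).
  case=> j /(simple_hom_iso Ssimple (Tsimple j)) [g [gpf _]].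
  by exists (g ∘ p j); rewrite -compA.
case: f0; rewrite -[f]comp1m -ip comp_summ big1 // => j _.
have [pf0|pf0] := pselect (p j ∘ f = 0); last by case: none; exists j.
by rewrite -compA pf0 compm0.
Qed.

Lemma split_epi_to_simple S X (f : Hom X S) :
  is_simple S -> f <> 0 -> is_split_epi f.
Proof.
move=> Ssimple f0.
have [n [T [Tsimple [i [p [_ _ ip]]]]]] := C_semisimple X.
have [|none] := pselect (exists j, f ∘ i j <> 0).
  case=> j fi0; have [g [_ fig]] := simple_hom_iso (Tsimple j) Ssimple fi0.
  by exists (i j ∘ g); rewrite compA.
case: f0; rewrite -[f]compm1 -ip compm_sum big1 // => j _.
have [fi0|fi0] := pselect (f ∘ i j = 0); last by case: none; exists j.
by rewrite compA fi0 comp0m.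
Qed.

(** The first summand of a decomposition of [X] into simple objects is then
    all of [X]. *)
Lemma simple_of_trivial_retracts X :
  ~ is_zero X ->
  (forall Y (i : Hom Y X) (p : Hom X Y),
     ~ is_zero Y -> p ∘ i = idm Y -> i ∘ p = idm X) ->
  is_simple X.
Proof.
move=> X0 trivX.
have [[|n] [T [Tsimple [i [p [pi _ ip]]]]]] := C_semisimple X.
  by case: X0; apply/is_zeroE; rewrite -ip big_ord0.
apply: (@isomorphic_simple (T ord0)); last exact: Tsimple.
exists (i ord0), (p ord0); split; first exact: pi.
apply: trivX; last exact: pi.
by case: (Tsimple ord0).
Qed.

(** A retract [i ∘ p] is an idempotent scalar, so it is [0] or [1]. *)
Lemma simple_of_scalar_End X :
  bijective (fun a : k => a *: idm X : Hom X X) -> is_simple X.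
Proof.
case=> s sK Ks; apply: simple_of_trivial_retracts.
  move/is_zeroE => X0; have /eqP := sK 1.
  by rewrite X0 scaler0 -[X in s X](scaler0 _ 0) -X0 sK eq_sym oner_eq0.
move=> Y i p Y0 pi; rewrite -(Ks (i ∘ p)).
have: i ∘ p ∘ i = i by rewrite -compA pi compm1.
rewrite -(Ks (i ∘ p)) compZm comp1m; set a := s _ => ai.
have [->|a1] := eqVneq a 1; first by rewrite scale1r.
have i0 : i = 0.
  apply/eqP; move/eqP: ai; rewrite -subr_eq0 -[X in _ - X]scale1r -scalerBl.
  by rewrite scaler_eq0 subr_eq0 (negbTE a1).
by case: Y0; apply/is_zeroE; rewrite -pi i0 compm0.
Qed.

End LinearCategories.

(** Post-composition with [f] is an endomorphism of the finite dimensional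
    space [End X]; for an eigenvalue [a], the morphism [f - a *: idm X] kills
    a nonzero morphism, so that it is not invertible and Schur's lemma makes it
    vanish. *)
Lemma simple_End_scalar (k : closedFieldType) (C : linear_category k) (X : C) :
  is_abelian C -> is_locally_finite C -> is_simple X ->
  bijective (fun a : k => a *: idm X : Hom X X).
Proof.
move=> C_abelian [homfin _] Xsimple.
have id0 : idm X <> 0 by case: Xsimple => X0 _ /is_zeroE.
have scalar (f : Hom X X) : exists a : k, a *: idm X = f.
  have [n [v [w vw wv]]] := homfin X X.
  have wlin : linear w by exact: can2_linear.
  have philin : linear (fun u : 'rV[k]_n => v (f ∘ w u)).
    by move=> a x y; rewrite wlin (comp_linear_r f) linearP.
  pose phi : {linear 'rV[k]_n -> 'rV[k]_n} :=
    HB.pack (fun u : 'rV[k]_n => v (f ∘ w u))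
      (GRing.isLinear.Build _ _ _ _ _ philin).
  have n_gt0 : (0 < n)%N.
    case: n v w vw {wv wlin philin phi} => // v w vw; case: id0.
    by rewrite -(vw (idm X)) -(vw 0) [v _]thinmx0 [v 0]thinmx0.
  have /closed_rootP [a] : size (char_poly (lin1_mx phi)) != 1.
    by rewrite size_char_poly; case: n n_gt0 {v w vw wv wlin philin phi}.
  rewrite -eigenvalue_root_char => /eigenvalueP [u].
  rewrite mul_rV_lin1 /= => fu u0; exists a; apply/eqP; rewrite eq_sym -subr_eq0.
  apply/eqP; apply: contrapT => fa0.
  have [g [gf _]] := simple_hom_iso C_abelian Xsimple Xsimple fa0.
  have wu0 : w u = 0.
    rewrite -[w u]comp1m -gf -compA compBm compZm comp1m.
    have -> : f ∘ w u = a *: w u by apply: (can_inj vw); rewrite fu linearZ /= wv.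
    by rewrite subrr compm0.
  by move: u0; rewrite -(wv u) wu0 linear0 eqxx.
have [s sP] := choice scalar; exists s => // a.
have /eqP := sP (a *: idm X).
rewrite -subr_eq0 -scalerBl scaler_eq0 subr_eq0 => /orP [/eqP //|/eqP].
by [].
Qed.

(** * Retracts of the unit object *)

Section Monoidal.
Variables (k : fieldType) (C : monoidal_linear_category k).
Implicit Types X Y T : C.
Local Notation "1" := (unit_ob C) : cat_scope.

Lemma luniti_nat X Y (f : Hom X Y) :
  luniti Y ∘ f = (idm 1 ⊗⊗ f) ∘ luniti X.
Proof.
rewrite -[LHS]compm1 -(lunitK X) !compA -(compA _ f) -lunit_nat.
by rewrite !compA lunitiK comp1m.
Qed.

Lemma runiti_nat X Y (f : Hom X Y) :
  runiti Y ∘ f = (f ⊗⊗ idm 1) ∘ runiti X.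
Proof.
rewrite -[LHS]compm1 -(runitK X) !compA -(compA _ f) -runit_nat.
by rewrite !compA runitiK comp1m.
Qed.

(** The two unitors of [1 ⊗ 1] agree, so naturality of the right one gives a
    statement about the left one. *)
Lemma lunit1_endo (e : Hom 1 1) : lunit 1 ∘ (e ⊗⊗ idm 1) = e ∘ lunit 1.
Proof. by rewrite lunit_runit1 runit_nat. Qed.

Lemma luniti1_endo (e : Hom 1 1) : (e ⊗⊗ idm 1) ∘ luniti 1 = luniti 1 ∘ e.
Proof. by rewrite luniti_runiti1 runiti_nat. Qed.

(** The retraction composes with [idm X ⊗⊗ u] on one side and [idm Y ⊗⊗ r] on
    the other, which make [X] a natural retract of [X ⊗ T]. It acts on the
    underlying morphisms, so that it serves for free modules and for cofree
    comodules alike. *)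
Lemma tensor_retraction T (u : Hom 1 T) (r : Hom T 1) : r ∘ u = idm 1 ->
  exists P : forall X Y, Hom (X ⊗ T) (Y ⊗ T) -> Hom X Y,
    (forall (X X' Y Y' : C) (f : Hom X' X) (h : Hom Y Y')
       (g : Hom (X ⊗ T) (Y ⊗ T)),
       P _ _ ((h ⊗⊗ idm T) ∘ g ∘ (f ⊗⊗ idm T)) = h ∘ P _ _ g ∘ f) /\
    (forall (X Y : C) (f : Hom X Y), P _ _ (f ⊗⊗ idm T) = f).
Proof.
move=> ru.
exists (fun X Y g =>
  runit Y ∘ (idm Y ⊗⊗ r) ∘ g ∘ (idm X ⊗⊗ u) ∘ runiti X); split.
  move=> X X' Y Y' f h g; rewrite -![in RHS]compA runiti_nat !compA.
  rewrite -(runit_nat h) -!compA; congr (_ ∘ _).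
  rewrite !(compA _ (_ ⊗⊗ idm 1)) -!tensmM !comp1m !compm1 !compA -!tensmM.
  rewrite !comp1m !compm1 -!compA; congr (_ ∘ (_ ∘ _)).
  by rewrite !compA -!tensmM !comp1m !compm1.
move=> X Y f.
rewrite -(compA _ _ (f ⊗⊗ _)) -(compA _ _ (idm X ⊗⊗ u)) -!tensmM.
by rewrite comp1m !compm1 ru runit_nat -compA runitK compm1.
Qed.

Section UnitRetract.
Variables (Y : C) (i : Hom Y 1) (p : Hom 1 Y).
Hypothesis pi : p ∘ i = idm Y.

Let iK : i ∘ p ∘ i = i. Proof. by rewrite -compA pi compm1. Qed.
Let pK : p ∘ i ∘ p = p. Proof. by rewrite pi comp1m. Qed.

(** The idempotent [i ∘ p] acts on [1 ⊗ Y] through the factor [1], but just as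
    well through [Y], where it is the identity. *)
Lemma retract_idem_tensm : (i ∘ p) ⊗⊗ idm Y = idm (1 ⊗ Y).
Proof.
suff lunitY : lunit Y ∘ ((i ∘ p) ⊗⊗ idm Y) = lunit Y.
  by rewrite -[LHS]comp1m -lunitiK -compA lunitY.
suff ilunitY : i ∘ lunit Y ∘ ((i ∘ p) ⊗⊗ idm Y) = i ∘ lunit Y.
  by rewrite -[LHS]comp1m -{1}pi -!compA (compA i) ilunitY compA pi comp1m.
rewrite -lunit_nat -compA -tensmM comp1m compm1 -{2}[i]comp1m.
by rewrite -[i ∘ p]compm1 tensmM !compA lunit1_endo -compA lunit_nat compA iK.
Qed.

Definition retract_mul := p ∘ lunit 1 ∘ (i ⊗⊗ i).
Definition retract_comul := (p ⊗⊗ p) ∘ luniti 1 ∘ i.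

(** The algebra and coalgebra axioms for [Y] reduce to those of the unit object
    once the idempotents [i ∘ p] created by composition are removed. They slide
    through the unitor and are absorbed by the outer [p] or [i]. *)
Let mul_absorbl X Z (x : Hom X 1) (z : Hom Z 1) :
  p ∘ lunit 1 ∘ ((i ∘ p ∘ x) ⊗⊗ z) = p ∘ lunit 1 ∘ (x ⊗⊗ z).
Proof.
by rewrite -[z in LHS]comp1m tensmM !compA -(compA p) lunit1_endo !compA pK.
Qed.

Let mul_absorbr X Z (x : Hom X 1) (z : Hom Z 1) :
  p ∘ lunit 1 ∘ (x ⊗⊗ (i ∘ p ∘ z)) = p ∘ lunit 1 ∘ (x ⊗⊗ z).
Proof.
by rewrite -[x in LHS]comp1m tensmM !compA -(compA p) lunit_nat !compA pK.
Qed.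

Let comul_absorbl X Z (x : Hom 1 X) (z : Hom 1 Z) :
  ((x ∘ (i ∘ p)) ⊗⊗ z) ∘ luniti 1 ∘ i = (x ⊗⊗ z) ∘ luniti 1 ∘ i.
Proof.
by rewrite -[z in LHS]compm1 tensmM -!(compA (x ⊗⊗ z)) luniti1_endo -compA iK.
Qed.

Let comul_absorbr X Z (x : Hom 1 X) (z : Hom 1 Z) :
  (x ⊗⊗ (z ∘ (i ∘ p))) ∘ luniti 1 ∘ i = (x ⊗⊗ z) ∘ luniti 1 ∘ i.
Proof.
by rewrite -[x in LHS]compm1 tensmM -!(compA (x ⊗⊗ z)) -luniti_nat -compA iK.
Qed.

Lemma retract_mulA :
  retract_mul ∘ (retract_mul ⊗⊗ idm Y) =
  retract_mul ∘ (idm Y ⊗⊗ retract_mul) ∘ assoc Y Y Y.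
Proof.
rewrite /retract_mul -!(compA _ (i ⊗⊗ i)) -!tensmM !compm1 !(compA i).
rewrite -!(compA (i ∘ p)) mul_absorbl mul_absorbr.
have -> : (lunit 1 ∘ (i ⊗⊗ i)) ⊗⊗ i = (lunit 1 ⊗⊗ idm 1) ∘ ((i ⊗⊗ i) ⊗⊗ i).
  by rewrite -tensmM comp1m.
have -> : i ⊗⊗ (lunit 1 ∘ (i ⊗⊗ i)) = (idm 1 ⊗⊗ lunit 1) ∘ (i ⊗⊗ (i ⊗⊗ i)).
  by rewrite -tensmM comp1m.
by rewrite -!compA -assoc_nat !compA -!(compA p) assoc_lunit1 !compA.
Qed.

Lemma retract_mul1m : retract_mul ∘ (p ⊗⊗ idm Y) = lunit Y.
Proof.
rewrite /retract_mul -compA -tensmM compm1 -[i ∘ p]compm1 mul_absorbl.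
by rewrite -compA lunit_nat compA pi comp1m.
Qed.

Lemma retract_mulm1 : retract_mul ∘ (idm Y ⊗⊗ p) = runit Y.
Proof.
rewrite /retract_mul -compA -tensmM compm1 -[i ∘ p]compm1 mul_absorbr.
by rewrite lunit_runit1 -compA runit_nat compA pi comp1m.
Qed.

Lemma retract_comulA :
  assoc Y Y Y ∘ (retract_comul ⊗⊗ idm Y) ∘ retract_comul =
  (idm Y ⊗⊗ retract_comul) ∘ retract_comul.
Proof.
rewrite /retract_comul !compA -(compA (assoc Y Y Y)) -!tensmM !comp1m.
rewrite -!(compA _ i p) -!(compA (assoc Y Y Y)) comul_absorbl comul_absorbr.
have -> : ((p ⊗⊗ p) ∘ luniti 1) ⊗⊗ p = ((p ⊗⊗ p) ⊗⊗ p) ∘ (luniti 1 ⊗⊗ idm 1).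
  by rewrite -tensmM compm1.
have -> : p ⊗⊗ ((p ⊗⊗ p) ∘ luniti 1) = (p ⊗⊗ (p ⊗⊗ p)) ∘ (idm 1 ⊗⊗ luniti 1).
  by rewrite -tensmM compm1.
rewrite !compA assoc_nat -!compA; congr (_ ∘ _).
by rewrite !compA assoc_luniti1.
Qed.

Lemma retract_comul1m : (i ⊗⊗ idm Y) ∘ retract_comul = luniti Y.
Proof.
rewrite /retract_comul !compA -tensmM comp1m -[i ∘ p]comp1m comul_absorbl.
by rewrite -luniti_nat -compA pi compm1.
Qed.

Lemma retract_comulm1 : (idm Y ⊗⊗ i) ∘ retract_comul = runiti Y.
Proof.
rewrite /retract_comul !compA -tensmM comp1m -[i ∘ p]comp1m comul_absorbr.
by rewrite luniti_runiti1 -runiti_nat -compA pi compm1.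
Qed.

Definition retract_algebra : algebra C :=
  Algebra retract_mulA retract_mul1m retract_mulm1.

Definition retract_coalgebra : coalgebra C :=
  Coalgebra retract_comulA retract_comul1m retract_comulm1.

Let retract_idem : i ∘ p ∘ (i ∘ p) = i ∘ p.
Proof. by rewrite compA iK. Qed.

Lemma retract_algebra_detects :
  detects_trivial_idempotents (free_module_functor retract_algebra) ->
  i ∘ p = idm 1.
Proof.
by apply=> //; apply: module_hom_inj; exact: retract_idem_tensm.
Qed.

Lemma retract_coalgebra_detects :
  detects_trivial_idempotents (cofree_comodule_functor retract_coalgebra) ->
  i ∘ p = idm 1.
Proof.
by apply=> //; apply: comodule_hom_inj; exact: retract_idem_tensm.
Qed.

Lemma retract_algebra_unit_mono :
  is_mono (alg_unit retract_algebra) -> i ∘ p = idm 1.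
Proof. by apply; rewrite /= compA pK compm1. Qed.

Lemma retract_coalgebra_counit_epi :
  is_epi (coalg_counit retract_coalgebra) -> i ∘ p = idm 1.
Proof. by apply; rewrite /= iK comp1m. Qed.

End UnitRetract.

(** * Split units and counits *)

(** A splitting of the unit of [A] makes [- ⊗ A] retract onto the identity
    functor. *)
Lemma split_unit_separable (A : algebra C) :
  is_split_mono (alg_unit A) -> separable (free_module_functor A).
Proof.
case=> r /tensor_retraction [P [Pnat PK]].
exists (fun X Y (g : module_hom (free_module A X) (free_module A Y)) =>
  P X Y (sval g)); split=> *; [exact: Pnat | exact: PK].
Qed.

Lemma split_counit_separable (D : coalgebra C) :
  is_split_epi (coalg_counit D) -> separable (cofree_comodule_functor D).
Proof.
case=> s /tensor_retraction [P [Pnat PK]].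
exists (fun X Y (g : comodule_hom (cofree_comodule D X) (cofree_comodule D Y)) =>
  P X Y (sval g)); split=> *; [exact: Pnat | exact: PK].
Qed.

Lemma alg_unit_morphism (A : algebra C) :
  @is_algebra_morphism _ C (unit_algebra C) A (alg_unit A).
Proof.
split; last exact: compm1.
have -> : alg_unit A ⊗⊗ alg_unit A =
    (alg_unit A ⊗⊗ idm A) ∘ (idm 1 ⊗⊗ alg_unit A).
  by rewrite -tensmM comp1m compm1.
by rewrite compA alg_mul1m lunit_nat.
Qed.

Lemma coalg_counit_morphism (D : coalgebra C) :
  @is_coalgebra_morphism _ C D (unit_coalgebra C) (coalg_counit D).
Proof.
split; last exact: comp1m.
have -> : coalg_counit D ⊗⊗ coalg_counit D =
    (idm 1 ⊗⊗ coalg_counit D) ∘ (coalg_counit D ⊗⊗ idm D).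
  by rewrite -tensmM comp1m compm1.
by rewrite -compA coalg_comul1m -luniti_nat.
Qed.

Hypothesis C_bilinear : bilinear_tensor C.

Lemma tensm0m X X' Y Y' (g : Hom Y Y') : (0 : Hom X X') ⊗⊗ g = 0.
Proof.
have := C_bilinear.1 X X' Y Y' g (-1) 0 0.
by rewrite scaler0 addr0 scaleN1r addNr.
Qed.

Lemma unit_zero X : is_zero 1 -> is_zero X.
Proof.
move/is_zeroE => id10; apply/is_zeroE.
by rewrite -lunitK -[lunit X]compm1 -tensm1 id10 tensm0m compm0 comp0m.
Qed.

Lemma alg_unit_neq0 (A : algebra C) : ~ is_zero A -> alg_unit A <> 0.
Proof.
move=> A0 u0; apply/A0/is_zeroE.
by rewrite -lunitK -alg_mul1m u0 tensm0m compm0 comp0m.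
Qed.

Lemma coalg_counit_neq0 (D : coalgebra C) : ~ is_zero D -> coalg_counit D <> 0.
Proof.
move=> D0 e0; apply/D0/is_zeroE.
by rewrite -lunitK -coalg_comul1m e0 tensm0m comp0m compm0.
Qed.

End Monoidal.

(** * Multifusion categories *)

Section Multifusion.
Variables (k : closedFieldType) (C : multitensor_category k).
Hypothesis C_semisimple : is_semisimple C.
Hypothesis C_nonzero : exists X : C, ~ is_zero X.
Local Notation "1" := (unit_ob C) : cat_scope.

Lemma simple_unit_split_mono (A : algebra C) :
  is_simple 1 -> ~ is_zero A -> is_split_mono (alg_unit A).
Proof.
move=> simple1 A0; apply: (split_mono_from_simple (mt_abelian C)) => //.
by apply: alg_unit_neq0 => //; exact: mt_bilinear.
Qed.

Lemma simple_unit_split_epi (D : coalgebra C) :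
  is_simple 1 -> ~ is_zero D -> is_split_epi (coalg_counit D).
Proof.
move=> simple1 D0; apply: (split_epi_to_simple (mt_abelian C)) => //.
by apply: coalg_counit_neq0 => //; exact: mt_bilinear.
Qed.

Let unit_simple := @simple_of_trivial_retracts k C C_semisimple 1.

Let unit_nonzero : ~ is_zero 1.
Proof.
case: C_nonzero => X X0 id10; apply/X0/unit_zero => //.
exact: mt_bilinear.
Qed.

Lemma simple_unit_algebra_detects :
  (forall A : algebra C, ~ is_zero A ->
     detects_trivial_idempotents (free_module_functor A)) ->
  is_simple 1.
Proof.
move=> detA; apply: unit_simple => // Y i p Y0 pi.
have := @retract_algebra_detects k C Y i p pi; apply; exact: detA.
Qed.

Lemma simple_unit_coalgebra_detects :
  (forall D : coalgebra C, ~ is_zero D ->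
     detects_trivial_idempotents (cofree_comodule_functor D)) ->
  is_simple 1.
Proof.
move=> detD; apply: unit_simple => // Y i p Y0 pi.
have := @retract_coalgebra_detects k C Y i p pi; apply; exact: detD.
Qed.

Lemma simple_unit_mono_units :
  is_simple 1 <-> forall A : algebra C, ~ is_zero A -> is_mono (alg_unit A).
Proof.
split=> [simple1 A /(simple_unit_split_mono simple1) [r ru] W g h gh|monoA].
  by rewrite -[g]comp1m -[h]comp1m -ru -!compA gh.
apply: unit_simple => // Y i p Y0 pi.
have := @retract_algebra_unit_mono k C Y i p pi; apply; exact: monoA.
Qed.

Lemma simple_unit_epi_counits :
  is_simple 1 <->
  forall D : coalgebra C, ~ is_zero D -> is_epi (coalg_counit D).
Proof.
split=> [simple1 D /(simple_unit_split_epi simple1) [s es] Z g h gh|epiD].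
  by rewrite -[g]compm1 -[h]compm1 -es !compA gh.
apply: unit_simple => // Y i p Y0 pi.
have := @retract_coalgebra_counit_epi k C Y i p pi; apply; exact: epiD.
Qed.

(** An algebra morphism out of [1] preserves the unit [idm 1], so it is the unit
    of its target, which vanishes exactly when the target does. *)
Lemma mono_units_mono_morphisms :
  (forall A : algebra C, ~ is_zero A -> is_mono (alg_unit A)) <->
  (forall (A : algebra C) (f : Hom (unit_algebra C) A),
     is_algebra_morphism f -> f <> 0 -> is_mono f).
Proof.
split=> [monoA A f [_ /= fu] f0|monof A A0].
  have -> : f = alg_unit A by rewrite -fu; symmetry; exact: compm1.
  by apply: monoA => /is_zeroE A0; apply: f0; rewrite -[f]comp1m A0 comp0m.
apply: (monof A); first exact: alg_unit_morphism.
by apply: alg_unit_neq0 => //; exact: mt_bilinear.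
Qed.

Lemma epi_counits_epi_morphisms :
  (forall D : coalgebra C, ~ is_zero D -> is_epi (coalg_counit D)) <->
  (forall (D : coalgebra C) (f : Hom D (unit_coalgebra C)),
     is_coalgebra_morphism f -> f <> 0 -> is_epi f).
Proof.
split=> [epiD D f [_ /= uf] f0|epif D D0].
  have -> : f = coalg_counit D by rewrite -uf; symmetry; exact: comp1m.
  by apply: epiD => /is_zeroE D0; apply: f0; rewrite -[f]compm1 D0 compm0.
apply: (epif D); first exact: coalg_counit_morphism.
by apply: coalg_counit_neq0 => //; exact: mt_bilinear.
Qed.

(** Any functor property that lies between separability and the detection of
    trivial idempotents, required of all nonzero algebras, characterizes
    simplicity of the unit. *)
Lemma simple_unit_algebra_property (Q : forall D : category, functor C D -> Prop) :
  (forall D (F : functor C D), separable F -> Q D F) ->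
  (forall D (F : functor C D), Q D F -> detects_trivial_idempotents F) ->
  is_simple 1 <->
  forall A : algebra C, ~ is_zero A -> Q _ (free_module_functor A).
Proof.
move=> sepQ Qdet; split=> [simple1 A A0|QA].
  by apply/sepQ/split_unit_separable/simple_unit_split_mono.
by apply: simple_unit_algebra_detects => A A0; apply/Qdet/QA.
Qed.

Lemma simple_unit_coalgebra_property
    (Q : forall D : category, functor C D -> Prop) :
  (forall D (F : functor C D), separable F -> Q D F) ->
  (forall D (F : functor C D), Q D F -> detects_trivial_idempotents F) ->
  is_simple 1 <->
  forall D : coalgebra C, ~ is_zero D -> Q _ (cofree_comodule_functor D).
Proof.
move=> sepQ Qdet; split=> [simple1 D D0|QD].
  by apply/sepQ/split_counit_separable/simple_unit_split_epi.
by apply: simple_unit_coalgebra_detects => D D0; apply/Qdet/QD.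
Qed.

End Multifusion.

Unset Implicit Arguments.

Theorem proposition4p4 (k : closedFieldType) (C : multitensor_category k)
    (C_multifusion : is_multifusion C)
    (C_nonzero : exists X : C, ~ is_zero X) :
  (is_simple (unit_ob C) <-> is_fusion C) /\
  [<->
    is_simple (unit_ob C);
    (forall A : algebra C, ~ is_zero A -> separable (free_module_functor A));
    (forall D : coalgebra C, ~ is_zero D -> separable (cofree_comodule_functor D));
    (forall A : algebra C, ~ is_zero A -> faithful (free_module_functor A));
    (forall D : coalgebra C, ~ is_zero D -> faithful (cofree_comodule_functor D));
    (forall A : algebra C, ~ is_zero A -> maschke (free_module_functor A));
    (forall D : coalgebra C, ~ is_zero D -> maschke (cofree_comodule_functor D));
    (forall A : algebra C, ~ is_zero A -> dual_maschke (free_module_functor A));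
    (forall D : coalgebra C, ~ is_zero D -> dual_maschke (cofree_comodule_functor D));
    (forall A : algebra C, ~ is_zero A -> conservative (free_module_functor A));
    (forall D : coalgebra C, ~ is_zero D -> conservative (cofree_comodule_functor D));
    (forall A : algebra C, ~ is_zero A -> is_mono (alg_unit A));
    (forall D : coalgebra C, ~ is_zero D -> is_epi (coalg_counit D));
    (forall (A : algebra C) (f : Hom (unit_algebra C) A),
                is_algebra_morphism f -> f <> 0 -> is_mono f);
    (forall (D : coalgebra C) (f : Hom D (unit_coalgebra C)),
                is_coalgebra_morphism f -> f <> 0 -> is_epi f)].
Proof.
have [_ C_ss] := C_multifusion.
split.
  split=> [simple1|[_ scalar1]]; last exact: (simple_of_scalar_End C_ss scalar1).
  split=> //; apply: simple_End_scalar => //; first exact: mt_abelian.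
  exact: mt_locally_finite.
have alg Q := @simple_unit_algebra_property k C C_ss C_nonzero Q.
have coalg Q := @simple_unit_coalgebra_property k C C_ss C_nonzero Q.
have sep_det D (F : functor C D) : separable F -> detects_trivial_idempotents F.
  by move/separable_faithful/faithful_detects.
have E2 := alg (@separable C) (fun _ _ => id) sep_det.
have E3 := coalg (@separable C) (fun _ _ => id) sep_det.
have E4 := alg _ (@separable_faithful C) (@faithful_detects C).
have E5 := coalg _ (@separable_faithful C) (@faithful_detects C).
have E6 := alg _ (@separable_maschke C) (@maschke_detects C).
have E7 := coalg _ (@separable_maschke C) (@maschke_detects C).
have E8 := alg _ (@separable_dual_maschke C) (@dual_maschke_detects C).
have E9 := coalg _ (@separable_dual_maschke C) (@dual_maschke_detects C).
have E10 := alg _ (@separable_conservative C) (@conservative_detects C).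
have E11 := coalg _ (@separable_conservative C) (@conservative_detects C).
have E12 := simple_unit_mono_units C_ss C_nonzero.
have E13 := simple_unit_epi_counits C_ss C_nonzero.
have E14 := iff_trans E12 (mono_units_mono_morphisms C).
have E15 := iff_trans E13 (epi_counits_epi_morphisms C).
tfae.
- exact: E2.1.
- by move/E2.2/E3.1.
- by move/E3.2/E4.1.
- by move/E4.2/E5.1.
- by move/E5.2/E6.1.
- by move/E6.2/E7.1.
- by move/E7.2/E8.1.
- by move/E8.2/E9.1.
- by move/E9.2/E10.1.
- by move/E10.2/E11.1.
- by move/E11.2/E12.1.
- by move/E12.2/E13.1.
- by move/E13.2/E14.1.
- by move/E14.2/E15.1.
- exact: E15.2.
Qed.
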